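(* Let $\mu>0$. Then for all $r\in(0,\infty)$, $$S_{\mu+2}(r)\,S_\mu(r)-S_{\mu+1}(r)^2\ge 0.$$
   Context: For $\mu>0$ and $r>0$, the generalized Mathieu series is $S_\mu(r)=\sum_{n=1}^\infty \frac{2n}{(n^2+r^2)^{\mu+1}}$. *)

(* Defs.v *)
From Stdlib Require Import Reals.
From Coquelicot Require Import Coquelicot.
Open Scope R_scope.

(* The summation index n >= 1 of the Mathieu series is S k for k >= 0.
   Rpower is the real power of a positive base (here n^2 + r^2 > 0).
   The k-th term is O(k^(-2 mu - 1)), so the series converges for mu > 0 and
   Series is then its actual sum. *)
Definition mathieu (mu r : R) : R :=
  Series (fun k : nat => 2 * INR (S k) / Rpower (INR (S k) ^ 2 + r ^ 2) (mu + 1)).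

(* Main.v *)
(** Writing [c_n = 2 n / (n^2 + r^2)^(mu + 1)] and [q_n = 1 / (n^2 + r^2)], the three
    Mathieu sums are the moments [sum c_n], [sum c_n q_n], [sum c_n q_n^2], so the
    inequality is Cauchy-Schwarz with weights [c_n]. Convergence follows by comparison
    with the telescoping series of [x_n^(-mu) - x_(n+1)^(-mu)], [x_n = n^2 + r^2],
    through the convexity of [x^(-mu)]. *)

Require Import Defs.
From Stdlib Require Import Reals Lra.
From Coquelicot Require Import Coquelicot.
Open Scope R_scope.

(** No sign of [c] is assumed, so the minimiser [- b / c] may be undefined; the cases on [a] and [b]
    use values of [t] that avoid dividing by [c] when it may vanish. *)
Lemma discriminant_le (a b c : R) :
  (forall t, 0 <= a + 2 * b * t + c * t ^ 2) -> b ^ 2 <= a * c.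
Proof.
  intros H.
  assert (Ha : 0 <= a) by (specialize (H 0); lra).
  destruct (Req_dec a 0) as [a0 | a0].
  - subst a.
    assert (Hc : 0 <= c) by (pose proof (H 1); pose proof (H (-1)); lra).
    (* The denominator [c + 1] is positive even when [c = 0]. The value at this point is a
       nonpositive multiple of the square of [b / (c + 1)], which forces [b = 0]. *)
    pose proof (H (- b / (c + 1))) as H1.
    replace (0 + 2 * b * (- b / (c + 1)) + c * (- b / (c + 1)) ^ 2)
      with (- ((b / (c + 1)) ^ 2 * (c + 2))) in H1 by (field; lra).
    assert (H2 : b ^ 2 = (b / (c + 1)) ^ 2 * (c + 1) ^ 2) by (field; lra).
    pose proof (pow2_ge_0 (b / (c + 1))).
    assert (H3 : (b / (c + 1)) ^ 2 = 0) by nra.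
    rewrite H2, H3; lra.
  - destruct (Req_dec b 0) as [b0 | b0].
    + subst b.
      assert (Hc : 0 <= c).
      { destruct (Rle_lt_dec 0 c) as [h | h]; [exact h |].
        (* If [c < 0], put [s = a / - c > 0]; at [t = 1 + s] the polynomial equals
           [c * (1 + s + s ^ 2) < 0]. *)
        pose proof (H (1 + a / - c)) as H1.
        assert (H2 : 0 < a / - c) by (apply Rdiv_lt_0_compat; lra).
        assert (H3 : a = a / - c * - c) by (field; lra).
        nra. }
      nra.
    (* At this point the value is the discriminant gap [a * c - b ^ 2] times a positive factor. *)
    + pose proof (H (- a / b)) as H1.
      replace (a + 2 * b * (- a / b) + c * (- a / b) ^ 2)
        with (a / b ^ 2 * (a * c - b ^ 2)) in H1 by (field; lra).
      assert (H2 : 0 < a / b ^ 2) by (apply Rdiv_lt_0_compat; nra).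
      nra.
Qed.

Lemma Series_nonneg (a : nat -> R) :
  (forall n, 0 <= a n) -> ex_series a -> 0 <= Series a.
Proof.
  intros Ha Ea.
  replace 0 with (Series (fun n => 0 * a n)) by (rewrite Series_scal_l; ring).
  apply Series_le; [| exact Ea].
  intros n; specialize (Ha n); lra.
Qed.

(** For each [t], the sum of [c n * (1 + t * q n) ^ 2] is a nonnegative quadratic in [t] whose
    coefficients are the three moments. *)
Lemma Series_moments_cauchy_schwarz (c q : nat -> R) :
  (forall n, 0 <= c n) ->
  ex_series c -> ex_series (fun n => c n * q n) -> ex_series (fun n => c n * q n ^ 2) ->
  Series (fun n => c n * q n) ^ 2 <= Series c * Series (fun n => c n * q n ^ 2).
Proof.
  intros Hc E0 E1 E2.
  apply discriminant_le; intros t.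
  assert (E1t : ex_series (fun n => 2 * t * (c n * q n)))
    by exact (ex_series_scal_l (2 * t) _ E1).
  assert (E2t : ex_series (fun n => t ^ 2 * (c n * q n ^ 2)))
    by exact (ex_series_scal_l (t ^ 2) _ E2).
  assert (E01 : ex_series (fun n => c n + 2 * t * (c n * q n)))
    by exact (ex_series_plus _ _ E0 E1t).
  assert (E : ex_series (fun n => c n + 2 * t * (c n * q n) + t ^ 2 * (c n * q n ^ 2)))
    by exact (ex_series_plus _ _ E01 E2t).
  apply Series_nonneg in E.
  - rewrite Series_plus, Series_plus, !Series_scal_l in E by assumption.
    lra.
  - intros n.
    replace (c n + 2 * t * (c n * q n) + t ^ 2 * (c n * q n ^ 2))
      with (c n * (1 + t * q n) ^ 2) by ring.
    apply Rmult_le_pos; [apply Hc | apply pow2_ge_0].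
Qed.

(* The tangent line of the convex function [x^(-mu)] at [y] lies below its graph. *)
Lemma Rpower_opp_tangent (mu x y : R) :
  0 <= mu -> 0 < x -> 0 < y ->
  mu * (y - x) / Rpower y (mu + 1) <= Rpower x (- mu) - Rpower y (- mu).
Proof.
  intros Hmu Hx Hy.
  assert (Ht : 0 < x / y) by (apply Rdiv_lt_0_compat; assumption).
  assert (Hln : ln (x / y) <= x / y - 1).
  { pose proof (exp_ineq1_le (ln (x / y))) as H; rewrite exp_ln in H by exact Ht; lra. }
  (* The tangent at 1 comes from [exp z >= 1 + z] with [z = - mu * ln (x / y)], combined with the
     bound on [ln]; multiplying by [Rpower y (- mu)] moves it to [y]. *)
  assert (H1 : 1 + mu * (1 - x / y) <= Rpower (x / y) (- mu)).
  { unfold Rpower; pose proof (exp_ineq1_le (- mu * ln (x / y))); nra. }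
  assert (Hy' : 0 < Rpower y (- mu)) by apply exp_pos.
  assert (H2 : Rpower x (- mu) = Rpower (x / y) (- mu) * Rpower y (- mu)).
  { rewrite Rpower_mult_distr by assumption; f_equal; field; lra. }
  assert (H3 : mu * (y - x) / Rpower y (mu + 1)
               = mu * (1 - x / y) * Rpower y (- mu)).
  { rewrite Rpower_Ropp, Rpower_plus, Rpower_1 by assumption.
    field; split; [apply Rgt_not_eq, exp_pos | lra]. }
  rewrite H2, H3; nra.
Qed.

Lemma mathieu_term_nonneg (nu r : R) (k : nat) :
  0 <= 2 * INR (S k) / Rpower (INR (S k) ^ 2 + r ^ 2) nu.
Proof.
  apply Rle_mult_inv_pos; [pose proof (pos_INR (S k)); lra | apply exp_pos].
Qed.

Lemma ex_series_mathieu (mu r : R) :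
  0 < mu -> 0 < r ->
  ex_series (fun k : nat => 2 * INR (S k) / Rpower (INR (S k) ^ 2 + r ^ 2) (mu + 1)).
Proof.
  intros Hmu Hr.
  set (a := fun k : nat => 2 * INR (S k) / Rpower (INR (S k) ^ 2 + r ^ 2) (mu + 1)).
  set (u := fun k : nat => Rpower (INR k ^ 2 + r ^ 2) (- mu)).
  assert (Hx : forall k, 0 < INR k ^ 2 + r ^ 2) by (intros k; nra).
  (* With [n = k + 1], consecutive bases differ by [2 * n - 1 >= n]. So the numerator [2 * n] is at
     most twice this gap, while [1 / mu] cancels the slope factor of the tangent. *)
  assert (Ha : forall k, a k <= 2 / mu * (u k - u (S k))).
  { intros k; unfold a, u.
    pose proof (Rpower_opp_tangent mu _ _ (Rlt_le _ _ Hmu) (Hx k) (Hx (S k))) as H.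
    apply Rmult_le_compat_l with (r := 2 / mu) in H;
      [| apply Rlt_le, Rdiv_lt_0_compat; lra].
    refine (Rle_trans _ _ _ _ H).
    replace (2 / mu * (mu * (INR (S k) ^ 2 + r ^ 2 - (INR k ^ 2 + r ^ 2)) /
                       Rpower (INR (S k) ^ 2 + r ^ 2) (mu + 1)))
      with (2 * (INR (S k) ^ 2 - INR k ^ 2) / Rpower (INR (S k) ^ 2 + r ^ 2) (mu + 1))
      by (field; split; [apply Rgt_not_eq, exp_pos | lra]).
    apply Rmult_le_compat_r; [apply Rlt_le, Rinv_0_lt_compat, exp_pos |].
    rewrite S_INR; pose proof (pos_INR k); nra. }
  assert (Hsum : forall n, sum_n a n <= 2 / mu * (u 0%nat - u (S n))).
  { induction n as [| n IH].
    - rewrite sum_O; apply Ha.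
    - rewrite sum_Sn; change plus with Rplus; specialize (Ha (S n)); lra. }
  (* Partial sums increase and stay below the first telescoping term, whose base is [r ^ 2 > 0]. *)
  apply ex_finite_lim_seq_incr with (M := 2 / mu * u 0%nat).
  - intros n; rewrite sum_Sn; change plus with Rplus.
    pose proof (mathieu_term_nonneg (mu + 1) r (S n)); fold (a (S n)) in *; lra.
  - intros n; refine (Rle_trans _ _ _ (Hsum n) _).
    apply Rmult_le_compat_l; [apply Rlt_le, Rdiv_lt_0_compat; lra |].
    pose proof (exp_pos (- mu * ln (INR (S n) ^ 2 + r ^ 2))) as H.
    fold (Rpower (INR (S n) ^ 2 + r ^ 2) (- mu)) in H; fold (u (S n)) in H; lra.
Qed.

Theorem theorem3 (mu : R) (hmu : 0 < mu) :
  forall r : R, 0 < r ->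
    mathieu (mu + 2) r * mathieu mu r - mathieu (mu + 1) r ^ 2 >= 0.
Proof.
  intros r Hr.
  set (x := fun k : nat => INR (S k) ^ 2 + r ^ 2).
  set (c := fun k : nat => 2 * INR (S k) / Rpower (x k) (mu + 1)).
  assert (Hx : forall k, 0 < x k) by (intros k; unfold x; nra).
  (* Raising the parameter by one multiplies each term by [/ x k]; the unsimplified exponents here
     and in [H2] match the unfolded [mathieu]. *)
  assert (H1 : forall k, 2 * INR (S k) / Rpower (x k) (mu + 1 + 1) = c k * / x k).
  { intros k; unfold c; rewrite (Rpower_plus (mu + 1)), Rpower_1 by apply Hx.
    field; split; [apply Rgt_not_eq, Hx | apply Rgt_not_eq, exp_pos]. }
  assert (H2 : forall k, 2 * INR (S k) / Rpower (x k) (mu + 2 + 1) = c k * (/ x k) ^ 2).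
  { intros k; unfold c; replace (mu + 2 + 1) with (mu + 1 + 1 + 1) by ring.
    rewrite (Rpower_plus (mu + 1 + 1)), (Rpower_plus (mu + 1)), Rpower_1 by apply Hx.
    field; split; [apply Rgt_not_eq, Hx | apply Rgt_not_eq, exp_pos]. }
  assert (E0 : ex_series c) by (apply ex_series_mathieu; assumption).
  assert (E1 : ex_series (fun k => c k * / x k)).
  { apply ex_series_ext with (1 := H1); apply ex_series_mathieu; lra. }
  assert (E2 : ex_series (fun k => c k * (/ x k) ^ 2)).
  { apply ex_series_ext with (1 := H2); apply ex_series_mathieu; lra. }
  assert (M1 : mathieu (mu + 1) r = Series (fun k => c k * / x k))
    by exact (Series_ext _ _ H1).
  assert (M2 : mathieu (mu + 2) r = Series (fun k => c k * (/ x k) ^ 2))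
    by exact (Series_ext _ _ H2).
  pose proof (Series_moments_cauchy_schwarz c (fun k => / x k)
                (mathieu_term_nonneg (mu + 1) r) E0 E1 E2) as H.
  rewrite M1, M2; change (mathieu mu r) with (Series c); lra.
Qed.
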